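(* Let $0<q<1$, let $X, X_0, X_1, X_2,\ldots$ be almost surely non-negative i.i.d. random variables with $\mathbb{E}\log\max(X,1)<\infty$, and let $S=\sum_{n=0}^\infty q^n X_n$. For $\lambda>0$ set $$F(\lambda):=-\log \mathbb{E} e^{-\lambda S},\qquad G(\lambda):=-\log \mathbb{E} e^{-\lambda X}.$$ Then for any $\lambda>1$, $$\sum_{0\leq n \leq \frac{\log \lambda}{\log (1/q)}} G(q^n \lambda) \;\leq\; F(\lambda) \;\leq\; F(1)+ \sum_{0\leq n \leq \frac{\log \lambda}{\log (1/q)}} G(q^n \lambda),$$ where the sums run over integers $n$ in the indicated range.
   Context: The condition $\mathbb{E}\log\max(X,1)<\infty$ is the necessary and sufficient condition for $S<\infty$ almost surely. *)

(* Defs.v *)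
From HB Require Import structures.
From mathcomp Require Import all_boot all_order all_algebra finmap.
From mathcomp Require Import all_classical all_reals all_analysis.

Set Implicit Arguments.
Unset Strict Implicit.
Unset Printing Implicit Defensive.

Import Order.TTheory GRing.Theory Num.Theory.
Import numFieldNormedType.Exports.

Local Open Scope classical_set_scope.
Local Open Scope ring_scope.

Definition mutually_independent (d : measure_display) (T : measurableType d)
    (R : realType) (P : probability T R) (I : choiceType)
    (Y : I -> {RV P >-> R}) : Prop :=
  forall (J : {fset I}) (B : I -> set R),
    (forall i, i \in J -> measurable (B i)) ->
    P (\bigcap_(i in [set` J]) (Y i @^-1` B i)) =
    (\prod_(i <- J) P (Y i @^-1` B i))%E.

Definition identically_distributed (d : measure_display)
    (T : measurableType d) (R : realType) (P : probability T R)
    (I : choiceType) (Y : I -> {RV P >-> R}) : Prop :=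
  forall (i j : I) (B : set R), measurable B ->
    distribution P (Y i) B = distribution P (Y j) B.

Definition iid (d : measure_display) (T : measurableType d) (R : realType)
    (P : probability T R) (I : choiceType) (Y : I -> {RV P >-> R}) : Prop :=
  mutually_independent Y /\ identically_distributed Y.

(* The family X, X_0, X_1, ... with None indexing X and Some n indexing X_n. *)
Definition adjoin (d : measure_display) (T : measurableType d) (R : realType)
    (P : probability T R) (X : {RV P >-> R}) (Xn : nat -> {RV P >-> R})
    (i : option nat) : {RV P >-> R} :=
  if i is Some n then Xn n else X.

(* The sum is taken in \bar R, so it is +oo where a series of non-negative
   terms diverges. *)
Definition perpetuity (d : measure_display) (T : measurableType d)
    (R : realType) (P : probability T R) (q : R) (Xn : nat -> {RV P >-> R})
    (w : T) : \bar R :=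
  (\sum_(0 <= n <oo) (q ^+ n * Xn n w)%:E)%E.

(* For l > 0, expeR (- (l * +oo)) = 0.  When Z is almost surely non-negative
   and not almost surely +oo, the expectation lies in ]0, 1], so neither
   [fine] nor [ln] is applied outside its natural domain. *)
Definition neg_log_laplace (d : measure_display) (T : measurableType d)
    (R : realType) (P : probability T R) (Z : T -> \bar R) (l : R) : R :=
  - ln (fine (\int[P]_w expeR (- (l%:E * Z w)))%E).

(* Main.v *)
Require Import Defs.
From HB Require Import structures.
From mathcomp Require Import all_boot all_order all_algebra finmap.
From mathcomp Require Import all_classical all_reals all_analysis.
From mathcomp Require Import measurable_realfun.

Set Implicit Arguments.
Unset Strict Implicit.
Unset Printing Implicit Defensive.

Import Order.TTheory GRing.Theory Num.Theory.
Import numFieldNormedType.Exports.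
Import HBNNSimple.

Local Open Scope classical_set_scope.
Local Open Scope ring_scope.

(** Write [Phi l] for the Laplace transform of the perpetuity and [phi l] for
    that of [X], so that [F = - ln Phi] and [G = - ln phi].  Splitting off the
    first [m] terms of the series leaves [q ^+ m] times an independent copy of the
    whole series, hence the functional equation
      [F lam = sum_(n < m) G (q ^+ n * lam) + F (q ^+ m * lam)]
    ([neg_log_laplace_perpetuity]).  When [m] is the number of [n] with
    [n <= ln lam / ln q^-1], that is with [1 <= q ^+ n * lam], the argument
    [q ^+ m * lam] is at most 1.  Since [F] is non-negative and non-decreasing,
    [0 <= F (q ^+ m * lam) <= F 1], which is the claim.

    The functional equation is obtained without constructing the independent copy.
    Independence gives the transform of every partial sum as a finite product
    ([expectation_prod_indep]), dominated convergence gives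
    [Phi l = prod_n phi (q ^+ n * l)] ([cvg_prod_laplace_perpetuity]), and the
    infinite product is cut at [m].

    Taking logarithms requires [Phi l > 0], that is, a series that is not almost
    surely infinite.  The logarithmic moment enters here: by Borel-Cantelli, it
    makes the series almost surely finite ([perpetuity_ae_lty]). *)

(** * Expectation of a product of independent random variables *)

(** Indicators of Borel sets are enough: both sides are linear in [f], hence
    agree on simple functions, and monotone convergence passes to the limit.
    Finiteness of the integral of [W] makes multiplication by it continuous. *)
Lemma integral_comp_mul_of_indic (d : measure_display) (T : measurableType d)
    (R : realType) (mu : {measure set T -> \bar R}) (Y W : T -> R) :
  measurable_fun setT Y -> measurable_fun setT W -> (forall w, 0 <= W w) ->
  (\int[mu]_w (W w)%:E)%E \is a fin_num ->
  (forall B, measurable B ->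
    \int[mu]_w (\1_B (Y w) * W w)%:E =
    \int[mu]_w (\1_B (Y w))%:E * \int[mu]_w (W w)%:E)%E ->
  forall f : R -> R, measurable_fun setT f -> (forall x, 0 <= f x) ->
  (\int[mu]_w (f (Y w) * W w)%:E =
    \int[mu]_w (f (Y w))%:E * \int[mu]_w (W w)%:E)%E.
Proof.
move=> mY mW W0 Wfin indicE f mf f0.
set c := (\int[mu]_w (W w)%:E)%E in Wfin indicE *.
have mef : measurable_fun setT (EFin \o f) by exact/measurable_EFinP.
pose g := nnsfun_approx measurableT mef.
have gf x : (g n x)%:E @[n --> \oo] --> (f x)%:E.
  by apply: (cvg_nnsfun_approx measurableT mef) => // y _; rewrite lee_fin.
have g_nd x : {homo (fun n => g n x) : n m / (n <= m)%N >-> n <= m}.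
  by move=> n m nm; have /lefP := nd_nnsfun_approx measurableT mef nm.
have mgY n : measurable_fun setT (fun w => g n (Y w)).
  exact: (measurableT_comp (measurable_funPT (g n))).
have gE n : (\int[mu]_w (g n (Y w) * W w)%:E = \int[mu]_w (g n (Y w))%:E * c)%E.
  have m1 (s : R) : measurable_fun setT (fun w => \1_(g n @^-1` [set s]) (Y w) : R).
    by apply: (measurableT_comp _ mY); exact: measurable_indic.
  have s0 (i : 'I_#|` fset_set (range (g n))|) :
      0 <= (fset_set (range (g n)))`_i.
    have := mem_nth 0 (ltn_ord i).
    by rewrite in_fset_set// => /set_mem[x _ <-].
  under eq_integral do rewrite fimfunEord mulr_suml -sumEFin.
  rewrite ge0_integral_sum//; last 2 first.
  - move=> i; apply/measurable_EFinP; apply: measurable_funM => //.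
    exact: measurable_funM.
  - by move=> i w _; rewrite lee_fin !mulr_ge0.
  under [in RHS]eq_integral do rewrite fimfunEord -sumEFin.
  rewrite ge0_integral_sum//; last 2 first.
  - by move=> i; apply/measurable_EFinP; exact: measurable_funM.
  - by move=> i w _; rewrite lee_fin !mulr_ge0.
  rewrite ge0_sume_distrl; last first.
    by move=> i _; apply: integral_ge0 => w _; rewrite lee_fin !mulr_ge0.
  apply: eq_bigr => i _.
  under eq_integral do rewrite -mulrA EFinM.
  rewrite ge0_integralZl_EFin//; last 2 first.
  - by move=> w _; rewrite lee_fin mulr_ge0.
  - by apply/measurable_EFinP; exact: measurable_funM.
  rewrite indicE; last first.
    by rewrite -[_ @^-1` _]setTI; exact: measurable_funPT.
  under [in RHS]eq_integral do rewrite EFinM.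
  rewrite ge0_integralZl_EFin//; last exact/measurable_EFinP.
  exact: muleA.
have lhs : (\int[mu]_w (g n (Y w) * W w)%:E @[n --> \oo] -->
    \int[mu]_w (f (Y w) * W w)%:E)%E.
  have -> : (\int[mu]_w (f (Y w) * W w)%:E =
      \int[mu]_w limn (fun n => (g n (Y w) * W w)%:E))%E.
    apply: eq_integral => w _; apply/esym/cvg_lim => //.
    under eq_fun do rewrite EFinM.
    by rewrite EFinM; apply: cvgeZr.
  apply: cvg_monotone_convergence => //.
  - by move=> n; apply/measurable_EFinP; exact: measurable_funM.
  - by move=> n w _; rewrite lee_fin mulr_ge0.
  - by move=> w _ n m nm; rewrite lee_fin ler_wpM2r// g_nd.
have rhs : (\int[mu]_w (g n (Y w))%:E * c @[n --> \oo] -->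
    \int[mu]_w (f (Y w))%:E * c)%E.
  apply: cvgeZr => //.
  have -> : (\int[mu]_w (f (Y w))%:E =
      \int[mu]_w limn (fun n => (g n (Y w))%:E))%E.
    by apply: eq_integral => w _; apply/esym/cvg_lim => //.
  apply: cvg_monotone_convergence => //.
  - by move=> n; apply/measurable_EFinP.
  - by move=> n w _; rewrite lee_fin.
  - by move=> w _ n m nm; rewrite lee_fin g_nd.
move: lhs; under eq_fun do rewrite gE.
by move=> /cvg_lim <-//; move/cvg_lim : rhs => <-.
Qed.

(** Mutual independence is the case where every factor is an indicator; the
    indicators are then replaced one at a time by the functions [f i].  For one
    such replacement the remaining factors play the role of the weight [W] in
    [integral_comp_mul_of_indic], so no independence of generated sigma-algebras
    has to be established. *)
Lemma expectation_prod_indep (d : measure_display) (T : measurableType d)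
    (R : realType) (P : probability T R) (I : choiceType)
    (Y : I -> {RV P >-> R}) (f : I -> R -> R) (s : seq I) :
  mutually_independent Y -> uniq s ->
  (forall i, measurable_fun setT (f i)) -> (forall i x, 0 <= f i x) ->
  (forall i, \int[P]_w (f i (Y i w))%:E \is a fin_num)%E ->
  (\int[P]_w (\prod_(i <- s) f i (Y i w))%:E =
    \prod_(i <- s) \int[P]_w (f i (Y i w))%:E)%E.
Proof.
move=> indY us mf f0 fin.
(* The indices in s already carry f, those in r still carry an indicator. *)
suff key (r : seq I) (B : I -> set R) : uniq (s ++ r) ->
    (forall i, measurable (B i)) ->
    (\int[P]_w (\prod_(i <- s) f i (Y i w) *
                \prod_(i <- r) \1_(B i) (Y i w))%:E =
     \prod_(i <- s) \int[P]_w (f i (Y i w))%:E *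
     \prod_(i <- r) \int[P]_w (\1_(B i) (Y i w))%:E)%E.
  have := key [::] (fun=> setT); rewrite cats0 big_nil mule1 => <-//.
  by under [RHS]eq_integral do rewrite big_nil mulr1.
have intE i (A : set R) : measurable A ->
    (\int[P]_w (\1_A (Y i w))%:E = P (Y i @^-1` A))%E.
  move=> mA; rewrite -[_ @^-1` _]setIT -integral_indic//.
  by rewrite -[_ @^-1` _]setTI; exact: measurable_funPT.
elim: s {us} r B => [r B ur mB|k s IH r B]; last first.
  rewrite /= mem_cat negb_or => /andP[/andP[ks kr] usr] mB.
  under eq_integral do rewrite big_cons -mulrA.
  rewrite big_cons -muleA.
  set C := (X in _ = (_ * X)%E).
  set W := fun w => \prod_(i <- s) f i (Y i w) * \prod_(i <- r) \1_(B i) (Y i w).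
  have indicM (A : set R) : measurable A ->
     (\int[P]_w (\1_A (Y k w) * W w)%:E = \int[P]_w (\1_A (Y k w))%:E * C)%E.
    (* An indicator at k is the induction hypothesis, with k moved to r. *)
    move=> mA; pose BA i := if i == k then A else B i.
    have BAr i : i \in r -> BA i = B i.
      by rewrite /BA; case: eqP => // ->; rewrite (negbTE kr).
    transitivity (\int[P]_w (\prod_(i <- s) f i (Y i w) *
        \prod_(i <- k :: r) \1_(BA i) (Y i w))%:E)%E.
      apply: eq_integral => w _; rewrite big_cons {1}/BA eqxx mulrCA /W.
      by congr (_ * (_ * _))%:E; apply: eq_big_seq => i /BAr ->.
    rewrite IH; last 2 first.
    - by rewrite (perm_uniq (_ : perm_eq _ (k :: s ++ r))) ?cons_uniq
        ?mem_cat ?negb_or ?ks ?kr// perm_catC /= perm_cons perm_catC.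
    - by move=> i; rewrite /BA; case: ifP.
    rewrite big_cons {1}/BA eqxx muleCA /C; congr (_ * (_ * _))%E.
    by apply: eq_big_seq => i /BAr ->.
  (* Taking the whole line as the set at k identifies the integral of W. *)
  have WE : (\int[P]_w (W w)%:E)%E = C.
    have := indicM setT measurableT; rewrite intE// preimage_setT probability_setT.
    rewrite mul1e => <-; apply: eq_integral => w _.
    by rewrite indicE in_setT mul1r.
  rewrite -WE; apply: integral_comp_mul_of_indic => //.
  - apply: measurable_funM; apply: measurable_prod => i _.
      exact: measurableT_comp.
    by apply: measurableT_comp => //; exact: measurable_indic.
  - by move=> w; rewrite mulr_ge0// prodr_ge0.
  - rewrite WE /C fin_numM// prode_fin_num// => i _.
    by rewrite intE// fin_num_measure// -[_ @^-1` _]setTI; exact: measurable_funPT.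
  - by move=> A mA; rewrite indicM// WE.
rewrite big_nil mul1e.
pose J := [fset i in r]%fset.
have perm_J : perm_eq r J.
  by apply: uniq_perm => // i; rewrite !inE.
under eq_bigr do rewrite intE//.
rewrite (perm_big _ perm_J)/= -indY//.
transitivity (\int[P]_w (\1_(\bigcap_(i in [set` J]) (Y i @^-1` B i)) w)%:E)%E.
  apply: eq_integral => w _; rewrite big_nil mul1r.
  congr (_%:E); rewrite (perm_big _ perm_J)/= indicE.
  case: (boolP (w \in _)) => [/set_mem wJ|].
    rewrite big_seq big1// => i iJ; rewrite indicE mem_set//; exact: wJ.
  rewrite notin_setE => /existsNP[i /not_implyP[iJ wi]].
  by rewrite (big_rem i)//= indicE memNset// mul0r.
rewrite integral_indic ?setIT//.
apply: fin_bigcap_measurable => // i _.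
by rewrite -[_ @^-1` _]setTI; exact: measurable_funPT.
Qed.

Lemma integral_comp_ident_distr (d : measure_display)
    (T : measurableType d) (R : realType) (P : probability T R)
    (I : choiceType) (Y : I -> {RV P >-> R}) (i j : I) (f : R -> R) :
  identically_distributed Y -> measurable_fun setT f ->
  (forall x, 0 <= f x) ->
  (\int[P]_w (f (Y i w))%:E = \int[P]_w (f (Y j w))%:E)%E.
Proof.
move=> idY mf f0.
have fE k : (\int[P]_w (f (Y k w))%:E = \int[distribution P (Y k)]_y (f y)%:E)%E.
  by rewrite ge0_integral_distribution//; exact/measurable_EFinP.
rewrite !fE; apply: eq_measure_integral => B mB _; exact: idY.
Qed.

(** * Almost sure finiteness of the perpetuity *)

(** Integrated, this bounds the sum over [n] of the tails at [n] of a
    non-negative random variable by its mean plus 1. *)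
Lemma nneseries_count_lt (R : realType) (v : R) : 0 <= v ->
  (\sum_(0 <= n <oo) ((n%:R < v)%R%:R)%:E <= (v + 1)%R%:E)%E.
Proof.
move=> v0; apply: lime_le.
  by apply: is_cvg_nneseries => n _ _; rewrite lee_fin.
apply: nearW => M; rewrite sumEFin lee_fin.
(* While M < v every term is at most 1; once M >= v the new terms vanish. *)
have count_le m : \sum_(0 <= n < m) (n%:R < v)%R%:R <= m%:R :> R.
  rewrite -[m in leRHS]subn0 -[leRHS]sumr_const_nat; apply: ler_sum => n _.
  by rewrite lern1 leq_b1.
elim: M => [|M IH]; first by rewrite big_geq// addr_ge0.
have [Mv|vM] := ltP M%:R v.
  by rewrite (le_trans (count_le _))// -natr1 lerD2r ltW.
by rewrite big_nat_recr//= ltNge vM addr0.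
Qed.

Lemma perpetuity_lty (d : measure_display) (T : measurableType d)
    (R : realType) (P : probability T R) (q : R) (Xn : nat -> {RV P >-> R})
    (w : T) (t : R) (N : nat) :
  0 < q -> 0 < t -> q * t < 1 -> (forall n, 0 <= Xn n w) ->
  (forall n, (N <= n)%N -> Xn n w <= t ^+ n) ->
  (perpetuity q Xn w < +oo)%E.
Proof.
move=> q0 t0 qt1 X0 Xle; have qt0 : 0 < q * t by exact: mulr_gt0.
have u0 n : (0 <= (q ^+ n * Xn n w)%:E)%E.
  by rewrite lee_fin mulr_ge0// exprn_ge0// ltW.
rewrite /perpetuity (nneseries_split 0 N)// add0n.
rewrite sumEFin lte_add_pinfty ?ltry//.
apply: (@le_lt_trans _ _ (((q * t) ^+ N) * (1 - q * t)^-1)%:E); last exact: ltry.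
apply: lime_le; first exact: is_cvg_nneseries.
near=> M; have NM : (N <= M)%N by near: M; exact: nbhs_infty_ge.
rewrite sumEFin lee_fin.
apply: (@le_trans _ _ (\sum_(N <= n < M) (q * t) ^+ n)).
  apply: ler_sum_nat => n /andP[Nn _].
  by rewrite exprMn ler_wpM2l ?exprn_ge0 ?Xle// ltW.
rewrite -(subnKC NM) geometric_partial_tail.
by apply: geometric_le_lim => //; rewrite ?exprn_ge0 ?ltW// gtr0_norm.
Unshelve. all: by end_near. Qed.

(** Borel-Cantelli: fix [t > 1] with [q * t < 1].  The events [t ^+ n < X_n] have
    the probabilities of [n < V] with [V = ln (max X 1) / ln t], which are
    summable because [V] is integrable.  So almost surely [X_n <= t ^+ n] from
    some [n] on, and the series is dominated by a geometric one. *)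
Lemma perpetuity_ae_lty (d : measure_display) (T : measurableType d)
    (R : realType) (P : probability T R) (q : R) (X : {RV P >-> R})
    (Xn : nat -> {RV P >-> R}) :
  0 < q < 1 -> identically_distributed (adjoin X Xn) ->
  (forall n, {ae P, forall w, 0 <= Xn n w}) ->
  ('E_P[fun w => ln (Num.max (X w) 1%R)] < +oo)%E ->
  {ae P, forall w, perpetuity q Xn w < +oo}%E.
Proof.
move=> /andP[q0 q1] idX X0 hlog.
(* The midpoint of ]1, q^-1[ meets both requirements on t. *)
pose t := (1 + q^-1) / 2.
have qV1 : 1 < q^-1 by rewrite invf_gt1.
have t1 : 1 < t by rewrite /t ltr_pdivlMr// mul1r ltrD2l.
have t0 : 0 < t by exact: lt_trans t1.
have qt1 : q * t < 1.
  by rewrite /t mulrA mulrDr mulr1 mulfV ?gt_eqF// ltr_pdivrMr// mul1r ltrD2r.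
have lnt0 : 0 < ln t by rewrite ln_gt0.
pose V w := ln (Num.max (X w) 1) / ln t.
have lnmax0 w : 0 <= ln (Num.max (X w) 1) by rewrite ln_ge0// le_max lexx orbT.
have V0 w : 0 <= V w by rewrite divr_ge0// ltW.
have mmax : measurable_fun setT (fun w => Num.max (X w) 1).
  by apply: measurable_maxr.
have mln : measurable_fun setT (fun w => ln (Num.max (X w) 1)).
  by apply: measurableT_comp => //; exact: measurable_ln.
have mV : measurable_fun setT V by exact: measurable_funM.
pose A n := Xn n @^-1` `]t ^+ n, +oo[.
have mA n : measurable (A n).
  by rewrite -[A n]setTI; apply: measurable_funPT.
have tailE n w : (t ^+ n < X w) = (n%:R < V w).
  have -> : (t ^+ n < X w) = (t ^+ n < Num.max (X w) 1).
    by rewrite lt_max [t ^+ n < 1]ltNge exprn_ege1 ?orbF// ltW.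
  rewrite /V ltr_pdivlMr// mulr_natl -lnXn//.
  by rewrite ltr_ln// posrE ?exprn_gt0// lt_max ltr01 orbT.
have mlt n : measurable_fun setT (fun w => ((n%:R < V w)%R%:R)%:E : \bar R).
  apply/measurable_EFinP.
  apply: (@measurable_comp _ _ _ _ _ _ setT (fun b : bool => b%:R : R)) => //.
  exact: measurable_fun_ltr.
have PA n : (P (A n) = \int[P]_w ((n%:R < V w)%R%:R)%:E)%E.
  transitivity (P (X @^-1` `]t ^+ n, +oo[)).
    exact: (idX (Some n) None).
  rewrite -[X in P X]setIT -integral_indic//; last first.
    by rewrite -[X in measurable X]setTI; apply: measurable_funPT.
  apply: eq_integral => w _; rewrite -tailE indicE; congr ((nat_of_bool _)%:R%:E).
  by apply/idP/idP => [/set_mem|h]; rewrite ?inE/= in_itv/= andbT.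
have sumA : (\sum_(0 <= n <oo) P (A n) < +oo)%E.
  rewrite (eq_eseriesr (fun n _ => PA n)) -integral_nneseries//.
  apply: (@le_lt_trans _ _ (\int[P]_w (V w + 1)%R%:E)%E).
    apply: ge0_le_integral => //.
    - by move=> w _; apply: nneseries_ge0 => n _ _; rewrite lee_fin.
    - apply: ge0_emeasurable_sum => //.
    - by apply/measurable_EFinP; exact: measurable_funD.
    - by move=> w _; exact: nneseries_count_lt.
  under eq_integral do rewrite EFinD.
  rewrite ge0_integralD//; last 2 first.
  - by move=> w _; rewrite lee_fin.
  - exact/measurable_EFinP.
  have -> : (\int[P]__ 1 = 1)%E.
    by rewrite integral_cst// mul1e; exact: probability_setT.
  rewrite lte_add_pinfty ?ltry//.
  under eq_integral do rewrite /V mulrC EFinM.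
  rewrite ge0_integralZl_EFin//; last 3 first.
  - by move=> w _; rewrite lee_fin.
  - exact/measurable_EFinP.
  - by rewrite invr_ge0 ltW.
  rewrite lte_mul_pinfty ?lee_fin ?invr_ge0 ?ltW//.
  by move: hlog; rewrite unlock.
have limA0 : {ae P, forall w, ~ lim_sup_set A w}.
  exists (lim_sup_set A); split; last by move=> w /= /contrapT.
  - by apply: bigcapT_measurable => n; exact: bigcup_measurable.
  - exact: lim_sup_set_cvg0.
have := ae_foralln X0.
apply: filterS2 limA0 => w nA Xw0.
have [N AN] : exists N, forall n, (N <= n)%N -> ~ A n w.
  apply: contrapT => /forallNP h; apply: nA => N _.
  by have /existsNP[n /not_implyP[Nn /contrapT Anw]] := h N; exists n.
apply: (@perpetuity_lty _ _ _ _ _ _ _ t N) => // n /AN.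
by rewrite /A /= in_itv/= andbT => /negP; rewrite -leNgt.
Qed.

(** * Laplace transforms of non-negative random variables *)

Lemma measurable_expeR (R : realType) : measurable_fun setT (@expeR R).
Proof.
have -> : @expeR R = fun x => if x == +oo%E then +oo%E
    else if x == -oo%E then 0%E else (expR (fine x))%:E.
  by apply/funext => -[].
apply: measurable_fun_ifT => //; first exact: measurable_fun_eqe.
apply: measurable_fun_ifT => //; first exact: measurable_fun_eqe.
apply/measurable_EFinP; apply: measurableT_comp; first exact: measurable_expR.
by [].
Qed.

Lemma measurable_laplace (d : measure_display) (T : measurableType d)
    (R : realType) (Z : T -> \bar R) (l : R) :
  measurable_fun setT Z ->
  measurable_fun setT (fun w => expeR (- (l%:E * Z w)))%E.
Proof.
move=> mZ; apply: measurableT_comp; first exact: measurable_expeR.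
by apply: measurableT_comp => //; exact: emeasurable_funM.
Qed.

Lemma le_laplace (d : measure_display) (T : measurableType d)
    (R : realType) (P : probability T R) (Z : T -> \bar R) (l l' : R) :
  measurable_fun setT Z -> {ae P, forall w, 0 <= Z w}%E -> l <= l' ->
  (\int[P]_w expeR (- (l'%:E * Z w)) <= \int[P]_w expeR (- (l%:E * Z w)))%E.
Proof.
move=> mZ Z0 ll'; apply: ae_ge0_le_integral => //.
- by move=> w _; exact: expeR_ge0.
- exact: measurable_laplace.
- by move=> w _; exact: expeR_ge0.
- exact: measurable_laplace.
- apply: filterS Z0 => w Zw _.
  by rewrite lee_expeR leeN2 lee_wpmul2r ?lee_fin.
Qed.

Lemma laplace_le1 (d : measure_display) (T : measurableType d)
    (R : realType) (P : probability T R) (Z : T -> \bar R) (l : R) :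
  measurable_fun setT Z -> {ae P, forall w, 0 <= Z w}%E -> 0 <= l ->
  (\int[P]_w expeR (- (l%:E * Z w)) <= 1)%E.
Proof.
move=> mZ Z0 l0; apply: (le_trans (le_laplace mZ Z0 l0)).
under eq_integral do rewrite mul0e oppe0 expeR0.
by rewrite integral_cst// mul1e; exact: probability_le1.
Qed.

(** A vanishing integral would force [expeR (- (l%:E * Z w)) = 0] almost
    everywhere, which a finite [Z w] excludes. *)
Lemma laplace_gt0 (d : measure_display) (T : measurableType d)
    (R : realType) (P : probability T R) (Z : T -> \bar R) (l : R) :
  measurable_fun setT Z -> {ae P, forall w, 0 <= Z w}%E ->
  {ae P, forall w, Z w < +oo}%E ->
  (0 < \int[P]_w expeR (- (l%:E * Z w)))%E.
Proof.
move=> mZ Z0 Zoo.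
have mL := measurable_laplace l mZ.
rewrite lt0e integral_ge0 ?andbT; last by move=> w _; exact: expeR_ge0.
apply/eqP => int0.
have /(ae_eq_integral_abs P measurableT mL) L0 :
    (\int[P]_w `|expeR (- (l%:E * Z w))| = 0)%E.
  by rewrite -[RHS]int0; apply: eq_integral => w _; rewrite gee0_abs ?expeR_ge0.
have P0 : (0 < P setT)%E by rewrite [P _]probability_setT.
have F := ae_properfilter_algebraOfSetsType P0.
have : {ae P, forall w, False}.
  apply: filterS3 L0 Z0 Zoo => w /(_ I)/eqP; rewrite expeR_eq0 => /eqP.
  by case: (Z w).
by move=> /filter_ex[].
Qed.

Lemma laplace_fin_num (d : measure_display) (T : measurableType d)
    (R : realType) (P : probability T R) (Z : T -> \bar R) (l : R) :
  measurable_fun setT Z -> {ae P, forall w, 0 <= Z w}%E -> 0 <= l ->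
  (\int[P]_w expeR (- (l%:E * Z w)))%E \is a fin_num.
Proof.
move=> mZ Z0 l0; rewrite ge0_fin_numE.
  by rewrite (le_lt_trans (laplace_le1 mZ Z0 l0))// ltry.
by apply: integral_ge0 => w _; exact: expeR_ge0.
Qed.

Lemma fine_laplace_itv (d : measure_display) (T : measurableType d)
    (R : realType) (P : probability T R) (Z : T -> \bar R) (l : R) :
  measurable_fun setT Z -> {ae P, forall w, 0 <= Z w}%E ->
  {ae P, forall w, Z w < +oo}%E -> 0 <= l ->
  0 < fine (\int[P]_w expeR (- (l%:E * Z w)))%E <= 1.
Proof.
move=> mZ Z0 Zoo l0.
rewrite -lte_fin -lee_fin fineK ?laplace_fin_num//.
by rewrite laplace_gt0// laplace_le1.
Qed.

Lemma neg_log_laplace_ge0 (d : measure_display) (T : measurableType d)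
    (R : realType) (P : probability T R) (Z : T -> \bar R) (l : R) :
  measurable_fun setT Z -> {ae P, forall w, 0 <= Z w}%E ->
  {ae P, forall w, Z w < +oo}%E -> 0 <= l -> 0 <= neg_log_laplace P Z l.
Proof.
move=> mZ Z0 Zoo l0; have /andP[I0 I1] := fine_laplace_itv mZ Z0 Zoo l0.
by rewrite oppr_ge0 ln_le0.
Qed.

Lemma le_neg_log_laplace (d : measure_display) (T : measurableType d)
    (R : realType) (P : probability T R) (Z : T -> \bar R) (l l' : R) :
  measurable_fun setT Z -> {ae P, forall w, 0 <= Z w}%E ->
  {ae P, forall w, Z w < +oo}%E -> 0 <= l -> l <= l' ->
  neg_log_laplace P Z l <= neg_log_laplace P Z l'.
Proof.
move=> mZ Z0 Zoo l0 ll'.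
have /andP[I0 I1] := fine_laplace_itv mZ Z0 Zoo l0.
have /andP[I'0 I'1] := fine_laplace_itv mZ Z0 Zoo (le_trans l0 ll').
rewrite lerN2 ler_ln// fine_le//; last exact: le_laplace.
  by rewrite laplace_fin_num// (le_trans l0).
exact: laplace_fin_num.
Qed.

(** * The functional equation of the Laplace transform of a perpetuity *)

(** Needed without any convergence assumption, because the terms of a
    perpetuity may be negative on a null set, where its partial sums need not
    converge; there [limn] takes a constant default value. *)
Lemma measurable_limn (d : measure_display) (T : measurableType d)
    (R : realType) (f : nat -> T -> \bar R) :
  (forall n, measurable_fun setT (f n)) ->
  measurable_fun setT (fun w => limn (f ^~ w)).
Proof.
move=> mf.
have mfN n : measurable_fun setT (fun w => - f n w)%E by exact: measurableT_comp.
have mE : measurable_fun setT (fun w => limn_esup (f ^~ w)).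
  exact: measurable_fun_limn_esup.
have mI : measurable_fun setT (fun w => limn_einf (f ^~ w)).
  apply: measurableT_comp => //.
  exact: (@measurable_fun_limn_esup _ _ _ _ (fun n w => - f n w)%E).
(* Convergence in the extended reals means that limsup and liminf agree. *)
have -> : (fun w => limn (f ^~ w)) = (fun w =>
    if limn_esup (f ^~ w) == limn_einf (f ^~ w) then limn_esup (f ^~ w)
    else point).
  apply/funext => w; case: ifPn => [/eqP e|ne]; last first.
    apply: dvgP => cf; move/eqP: ne; apply.
    by rewrite is_cvg_limn_esupE// is_cvg_limn_einfE.
  apply/cvg_lim => //.
  have cE : esups (f ^~ w) n @[n --> \oo] --> limn_esup (f ^~ w).
    by rewrite limn_esup_lim; exact: is_cvg_esups.
  have cI : einfs (f ^~ w) n @[n --> \oo] --> limn_esup (f ^~ w).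
    by rewrite e limn_einf_lim; exact: is_cvg_einfs.
  apply: squeeze_cvge cI cE; apply: nearW => n; apply/andP; split.
    by apply: ge_ereal_inf; exists (f n w) => //; exists n => /=.
  by apply: le_ereal_sup_tmp; exists (f n w) => //; exists n => /=.
by apply: measurable_fun_ifT => //; exact: measurable_fun_eqe.
Qed.

Lemma measurable_perpetuity (d : measure_display) (T : measurableType d)
    (R : realType) (P : probability T R) (q : R) (Xn : nat -> {RV P >-> R}) :
  measurable_fun setT (perpetuity q Xn).
Proof.
apply: measurable_limn => n; apply: emeasurable_sum => i.
by apply/measurable_EFinP; exact: measurable_funM.
Qed.

Lemma perpetuity_ae_ge0 (d : measure_display) (T : measurableType d)
    (R : realType) (P : probability T R) (q : R) (Xn : nat -> {RV P >-> R}) :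
  0 <= q -> (forall n, {ae P, forall w, 0 <= Xn n w}) ->
  {ae P, forall w, 0 <= perpetuity q Xn w}%E.
Proof.
move=> q0 X0; have := ae_foralln X0; apply: filterS => w Xw0.
by apply: nneseries_ge0 => n _ _; rewrite lee_fin mulr_ge0// exprn_ge0.
Qed.

(** Independence factors the transform of each partial sum, whose terms
    [q ^+ n * X_n] have the law of [q ^+ n * X]; dominated convergence, with
    bound 1, then lets the number of terms tend to infinity. *)
Lemma cvg_prod_laplace_perpetuity (d : measure_display) (T : measurableType d)
    (R : realType) (P : probability T R) (q : R) (X : {RV P >-> R})
    (Xn : nat -> {RV P >-> R}) (l : R) :
  0 <= q -> iid (adjoin X Xn) -> {ae P, forall w, 0 <= X w} ->
  (forall n, {ae P, forall w, 0 <= Xn n w}) ->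
  {ae P, forall w, perpetuity q Xn w < +oo}%E -> 0 <= l ->
  \prod_(0 <= n < M)
    fine (\int[P]_w expeR (- ((q ^+ n * l)%:E * (X w)%:E)))%E @[M --> \oo] -->
  fine (\int[P]_w expeR (- (l%:E * perpetuity q Xn w)))%E.
Proof.
move=> q0 [indX idX] X0 Xn0 Soo l0.
pose c n := q ^+ n * l.
have c0 n : 0 <= c n by rewrite mulr_ge0// exprn_ge0.
have me n : measurable_fun setT (fun x : R => expR (- (c n * x))).
  apply: measurableT_comp; first exact: measurable_expR.
  by apply: measurableT_comp => //; exact: measurable_funM.
pose phi n := (\int[P]_w (expR (- (c n * X w)))%:E)%E.
have phifin n : phi n \is a fin_num.
  have mX : measurable_fun setT (EFin \o X) by exact/measurable_EFinP.
  by apply: (laplace_fin_num mX).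
pose Sn M w := \sum_(0 <= n < M) q ^+ n * Xn n w.
have prodE M : (\int[P]_w (expR (- (l * Sn M w)))%:E =
    (\prod_(0 <= n < M) fine (phi n))%:E)%E.
  (* The value at None, the index of X itself, is a filler. *)
  pose f (i : option nat) x := if i is Some n then expR (- (c n * x)) else 1.
  transitivity (\int[P]_w
      (\prod_(i <- map Some (index_iota 0 M)) f i (adjoin X Xn i w))%:E)%E.
    apply: eq_integral => w _; rewrite big_map /= -expR_sum.
    congr (expR _)%:E; rewrite /Sn mulr_sumr -sumrN; apply: eq_bigr => i _.
    by rewrite /c mulrA [l * _]mulrC.
  have fphi n : (\int[P]_w (f (Some n) (adjoin X Xn (Some n) w))%:E = phi n)%E.
    exact: (integral_comp_ident_distr (Some n) None idX (me n) (fun=> expR_ge0 _)).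
  rewrite expectation_prod_indep//.
  - rewrite big_map -prodEFin; apply: eq_bigr => n _.
    by rewrite fphi fineK.
  - by rewrite map_inj_uniq ?iota_uniq// => ? ? [].
  - by case=> [n|]; [exact: me|exact: measurable_cst].
  - by case=> [n|] x //=; rewrite ?expR_ge0.
  - case=> [n|]; first by rewrite fphi.
    change (\int[P]__ (1 : \bar R) \is a fin_num)%E.
    by rewrite integral_cst// mul1e; exact: fin_num_measure.
have mSn M : measurable_fun setT (Sn M).
  by apply: measurable_sum => n; exact: measurable_funM.
have mexpSn M : measurable_fun setT (fun w => (expR (- (l * Sn M w)))%:E).
  apply/measurable_EFinP; apply: measurableT_comp; first exact: measurable_expR.
  by apply: measurableT_comp => //; exact: measurable_funM.
have cvg_expSn : {ae P, forall w, setT w ->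
    (expR (- (l * Sn M w)))%:E @[M --> \oo] -->
    expeR (- (l%:E * perpetuity q Xn w))%E}.
  have := ae_foralln Xn0; apply: filterS2 Soo => w Swoo Xw0 _.
  have u0 n : (0 <= (q ^+ n * Xn n w)%:E)%E.
    by rewrite lee_fin mulr_ge0// exprn_ge0.
  have Swfin : perpetuity q Xn w \is a fin_num.
    by rewrite ge0_fin_numE//; exact: nneseries_ge0.
  rewrite -(fineK Swfin) /=; apply: cvg_EFin; first exact: nearW.
  apply: continuous_cvg; first exact: continuous_expR.
  apply: cvgN; apply: cvgMr.
  have -> : Sn ^~ w = fun M =>
      fine (\sum_(0 <= n < M) (q ^+ n * Xn n w)%:E)%E.
    by apply/funext => M; rewrite sumEFin.
  by apply: fine_cvg; rewrite fineK//; exact: is_cvg_nneseries.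
have expSn_le1 : {ae P, forall w, forall M, setT w ->
    (`|(expR (- (l * Sn M w)))%:E| <= cst 1 w)%E}.
  have := ae_foralln Xn0; apply: filterS => w Xw0 M _.
  rewrite /= lee_fin ger0_norm ?expR_ge0// -expR0 ler_expR oppr_le0.
  by rewrite mulr_ge0// sumr_ge0// => n _; rewrite mulr_ge0// exprn_ge0.
have [intS _ cvgS] := dominated_convergence measurableT mexpSn
  (measurable_laplace l (measurable_perpetuity q Xn)) cvg_expSn
  (finite_measure_integrable_cst P 1 measurableT) expSn_le1.
rewrite [X in X @ _ --> _](_ : _ =
    fun M => fine (\int[P]_w (expR (- (l * Sn M w)))%:E)%E); last first.
  by apply/funext => M; rewrite prodE.
by apply: fine_cvg; rewrite fineK//; exact: integrable_fin_num intS.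
Qed.

(** Logarithmic form of the factorization
    [Phi l = prod_(n < m) phi (q ^+ n * l) * Phi (q ^+ m * l)] of the Laplace
    transforms [Phi] of the perpetuity and [phi] of [X].  It is read off the
    infinite product for [Phi l], whose tail from [m] on is the infinite product
    for [Phi (q ^+ m * l)].  All factors are positive, so [ln] is additive. *)
Lemma neg_log_laplace_perpetuity (d : measure_display) (T : measurableType d)
    (R : realType) (P : probability T R) (q : R) (X : {RV P >-> R})
    (Xn : nat -> {RV P >-> R}) (l : R) (m : nat) :
  0 <= q -> iid (adjoin X Xn) -> {ae P, forall w, 0 <= X w} ->
  (forall n, {ae P, forall w, 0 <= Xn n w}) ->
  {ae P, forall w, perpetuity q Xn w < +oo}%E -> 0 <= l ->
  neg_log_laplace P (perpetuity q Xn) l =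
  \sum_(0 <= n < m) neg_log_laplace P (fun w => (X w)%:E) (q ^+ n * l) +
  neg_log_laplace P (perpetuity q Xn) (q ^+ m * l).
Proof.
move=> q0 iidX X0 Xn0 Soo l0.
have qn0 n (k : R) : 0 <= k -> 0 <= q ^+ n * k.
  by move=> k0; rewrite mulr_ge0// exprn_ge0.
pose phi k := fine (\int[P]_w expeR (- (k%:E * (X w)%:E)))%E.
pose Phi k := fine (\int[P]_w expeR (- (k%:E * perpetuity q Xn w)))%E.
have mX : measurable_fun setT (EFin \o X) by exact/measurable_EFinP.
have phi_gt0 k : 0 <= k -> 0 < phi k.
  move=> k0; have /(_ _ _)/andP[]// := @fine_laplace_itv _ _ _ P _ k mX _ _ k0.
  by apply: aeW => w; exact: ltry.
have Phi_gt0 k : 0 <= k -> 0 < Phi k.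
  move=> k0; have /andP[]// := fine_laplace_itv (measurable_perpetuity q Xn)
    (perpetuity_ae_ge0 q0 Xn0) Soo k0.
have prod_gt0 j : 0 < \prod_(0 <= n < j) phi (q ^+ n * l).
  by apply: prodr_gt0 => n _; exact/phi_gt0/qn0.
have cvgPhi k := cvg_prod_laplace_perpetuity q0 iidX X0 Xn0 Soo (l := k).
have PhiE : Phi l = \prod_(0 <= n < m) phi (q ^+ n * l) * Phi (q ^+ m * l).
  have := cvgPhi _ l0; rewrite -(cvg_shiftn m) => /cvg_unique; apply => //.
  have -> : [sequence \prod_(0 <= n < M + m) phi (q ^+ n * l)]_M =
      fun M => \prod_(0 <= n < m) phi (q ^+ n * l) *
        \prod_(0 <= n < M) phi (q ^+ n * (q ^+ m * l)).
    apply/funext => M /=; rewrite (big_cat_nat _ (leq_addl M m))//=; congr (_ * _).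
    rewrite -{1}[m]add0n big_addn addnK; apply: eq_bigr => n _.
    by rewrite exprD mulrA.
  by apply: cvgMr; exact/cvgPhi/qn0.
have lnE j : - ln (\prod_(0 <= n < j) phi (q ^+ n * l)) =
    \sum_(0 <= n < j) - ln (phi (q ^+ n * l)).
  elim: j => [|j IH]; first by rewrite !big_geq// ln1 oppr0.
  rewrite !big_nat_recr//= -IH -opprD lnM// posrE//; exact/phi_gt0/qn0.
by rewrite /neg_log_laplace -/(Phi l) PhiE lnM ?posrE ?Phi_gt0 ?qn0// opprD lnE.
Qed.

Theorem lemma1 (d : measure_display) (T : measurableType d) (R : realType)
    (P : probability T R) (q : R) (X : {RV P >-> R})
    (Xn : nat -> {RV P >-> R})
    (hq : 0 < q < 1)
    (hiid : iid (adjoin X Xn))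
    (hX : {ae P, forall w, 0 <= X w})
    (hXn : forall n, {ae P, forall w, 0 <= Xn n w})
    (hlog : ('E_P[fun w => ln (Num.max (X w) 1%R)] < +oo)%E) :
  let S := perpetuity q Xn in
  let F := neg_log_laplace P S in
  let G := neg_log_laplace P (fun w => (X w)%:E) in
  forall lam : R, 1 < lam ->
    let N := [set n : nat | n%:R <= ln lam / ln q^-1] in
    \sum_(n \in N) G (q ^+ n * lam) <= F lam /\
    F lam <= F 1 + \sum_(n \in N) G (q ^+ n * lam).
Proof.
move=> S F G lam lam1 N.
case/andP: (hq) => q0 q1; case: (hiid) => _ idX.
have lam0 : 0 < lam by exact: lt_trans lam1.
have lnq0 : 0 < ln q^-1 by rewrite ln_gt0// invf_gt1.
have N0 : 0 <= ln lam / ln q^-1 by rewrite divr_ge0 ?(ltW lnq0)// ln_ge0// ltW.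
(* The range N has m elements, and m is the first exponent outside it, which
   is why q ^+ m * lam <= 1. *)
pose m := (Num.truncn (ln lam / ln q^-1)).+1.
have NE : N = `I_m.
  by apply/seteqP; split => n /=; rewrite ltnS truncn_ge_nat.
have mS : measurable_fun setT S by exact: measurable_perpetuity.
have S0 : {ae P, forall w, 0 <= S w}%E by apply: perpetuity_ae_ge0 => //; exact: ltW.
have Soo : {ae P, forall w, S w < +oo}%E by exact: perpetuity_ae_lty hlog.
have qm0 : 0 <= q ^+ m * lam by rewrite mulr_ge0 ?exprn_ge0// ltW.
have qm1 : q ^+ m * lam <= 1.
  have : lam <= q^-1 ^+ m.
    rewrite -ler_ln ?posrE ?exprn_gt0 ?invr_gt0// lnXn ?invr_gt0//.
    by rewrite -mulr_natl -ler_pdivrMr// ltW// truncnS_gt.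
  by rewrite exprVn -[_^-1]mul1r ler_pdivlMr ?exprn_gt0// mulrC.
have -> : F lam = \sum_(n \in N) G (q ^+ n * lam) + F (q ^+ m * lam).
  rewrite NE -fsbig_ord -(big_mkord xpredT (fun n => G (q ^+ n * lam))).
  by apply: neg_log_laplace_perpetuity => //; exact: ltW.
split; first by rewrite lerDl neg_log_laplace_ge0.
by rewrite addrC lerD2r le_neg_log_laplace.
Qed.
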